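(* Let $N\ge2$ and let $V$ be the set of decomposable unit vectors in a tensor product of nonzero finite dimensional complex Hilbert spaces $H=H_1\otimes\cdots\otimes H_N$, with $n_k=\dim H_k$ weakly increasing with $k$. Consider $\mathcal A=\mathcal B(H_1\otimes\cdots\otimes H_{N-1})$, viewed as a subfactor of $\mathcal B(H_1\otimes\cdots\otimes H_N)$ via $A\mapsto A\otimes\mathbf 1_{H_N}$, and let $\tau$ be the tracial state of $\mathcal A$. The following assertions are equivalent: (i) Minimality of the inner radius: $r(V)=(n_1\cdots n_{N-1})^{-1/2}$. (ii) Existence of purifications: there is a unit vector $\xi\in H_1\otimes\cdots\otimes H_N$ such that $\tau(A)=\langle(A\otimes\mathbf 1_{H_N})\xi,\xi\rangle$ for all $A\in\mathcal A$. (iii) Lower limit on $\dim H_N$: $n_N\ge n_1n_2\cdots n_{N-1}$.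
   Context: $V=\{\xi_1\otimes\cdots\otimes\xi_N:\xi_k\in H_k,\ \|\xi_1\|=\cdots=\|\xi_N\|=1\}$. The inner radius $r(V)$ is the largest $r\ge0$ such that $\{\xi\in H:\|\xi\|\le r\}$ is contained in the closed convex hull of $V$. The tracial state is normalized: $\tau(A)=\operatorname{trace}(A)/(n_1\cdots n_{N-1})$. *)

(* Defs.v *)
From HB Require Import structures.
From mathcomp Require Import all_boot all_order all_algebra.
From mathcomp Require Import complex.
From mathcomp Require Import boolp classical_sets reals.

Set Implicit Arguments.
Unset Strict Implicit.
Unset Printing Implicit Defensive.

Import Order.TTheory GRing.Theory Num.Theory.

Local Open Scope classical_set_scope.
Local Open Scope ring_scope.
Local Open Scope complex_scope.

(* Inner products are linear in the first variable and conjugate-linear in the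
   second one: this is the convention of [{dot _ for _}]. *)
Record fdHilbert (R : realType) := FdHilbert {
  hspace :> vectType R[i];
  inner : {dot hspace for @Num.conj R[i]}
}.

Definition hnorm (R : realType) (H : fdHilbert R) (x : H) : R :=
  Num.sqrt (complex.Re (inner H x x)).

Definition multilinear (F : fieldType) (I : finType) (H : I -> vectType F)
    (Z : vectType F) (f : (forall i, H i) -> Z) : Prop :=
  forall (i : I) (x : forall i, H i) (a : F) (u v : H i),
    f (dfwith x (a *: u + v)) = a *: f (dfwith x u) + f (dfwith x v).

(* A Hilbert space tensor product of the family [H], [pure] being the map
   (x_i)_i |-> \bigotimes_i x_i. Such an object is unique up to a unique unitary
   map compatible with [pure]. *)
Record tensorProduct (R : realType) (I : finType) (H : I -> fdHilbert R) :=
  TensorProduct {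
    tspace :> fdHilbert R;
    pure : (forall i, H i) -> tspace;
    pure_multilinear : multilinear pure;
    pure_universal : forall (Z : vectType R[i]) (f : (forall i, H i) -> Z),
      multilinear f -> exists! g : 'Hom(tspace, Z), forall x, g (pure x) = f x;
    inner_pure : forall x y,
      inner tspace (pure x) (pure y) = \prod_i inner (H i) (x i) (y i)
  }.

Definition decomposable_unit (R : realType) (I : finType)
    (H : I -> fdHilbert R) (T : tensorProduct H) : set T :=
  [set pure T x | x in [set x : forall i, H i | forall i, hnorm (x i) = 1]].

Arguments decomposable_unit {R I H} T.

Definition convex_hull (R : realType) (H : fdHilbert R) (V : set H) : set H :=
  [set x | exists (n : nat) (l : 'I_n -> R) (v : 'I_n -> H),
     [/\ forall i, 0 <= l i, \sum_i l i = 1, forall i, V (v i)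
       & x = \sum_i (l i)%:C *: v i]].

Definition norm_closure (R : realType) (H : fdHilbert R) (A : set H) : set H :=
  [set x | forall e : R, 0 < e -> exists2 y, A y & hnorm (x - y) < e].

(* [r] is the largest nonnegative real such that the closed ball of radius [r]
   is contained in the closed convex hull of [V]. *)
Definition is_inner_radius (R : realType) (H : fdHilbert R) (V : set H) (r : R)
    : Prop :=
  let admissible := [set s : R | 0 <= s /\
    [set x : H | hnorm x <= s] `<=` norm_closure (convex_hull V)] in
  admissible r /\ ubound admissible r.

Definition lfun_trace (F : fieldType) (U : vectType F) (A : 'End(U)) : F :=
  \tr (passmx.mxof (vbasis {:U}) (vbasis {:U}) A).

Lemma pure_extend (R : realType) (I : finType) (H : I -> fdHilbert R)
    (T : tensorProduct H) (Z : vectType R[i]) (f g : 'Hom(T, Z)) :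
  (forall x, f (pure T x) = g (pure T x)) -> f = g.
Proof.
move=> fg; have /(@pure_universal _ _ _ T)[h [_ hu]] :
    multilinear (fun x => f (pure T x)).
  by move=> i x a u v; rewrite pure_multilinear linearP.
by rewrite -(hu f) // -(hu g) // => x; rewrite fg.
Qed.

(* The factors H_1, ..., H_N are indexed from 0, by ['I_N]. *)
Definition lead (N : nat) : 'I_N.-1 -> 'I_N := widen_ord (leq_pred N).

Lemma last_proof (N : nat) : (1 < N)%N -> (N.-1 < N)%N.
Proof. by case: N. Qed.

Definition last_factor (N : nat) (hN : (1 < N)%N) : 'I_N :=
  Ordinal (last_proof hN).

Section Ampliation.
Variables (R : realType) (N : nat) (hN : (1 < N)%N) (H : 'I_N -> fdHilbert R).
Variables (K : tensorProduct (fun i => H (@lead N i))) (T : tensorProduct H).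

Let L : fdHilbert R := H (last_factor hN).

Lemma lead_or_last (k : 'I_N) :
  {i : 'I_N.-1 | lead i = k} + {last_factor hN = k}.
Proof.
have [kN|Nk] := ltnP k N.-1.
  by left; exists (Ordinal kN); apply: val_inj.
right; apply: val_inj; apply/eqP; rewrite eqn_leq Nk /=.
by rewrite -ltnS prednK // ltnW.
Qed.

Lemma lead_neq_last (i : 'I_N.-1) : lead i != last_factor hN.
Proof. by rewrite -val_eqE /= neq_ltn ltn_ord. Qed.

Lemma lead_inj : injective (@lead N).
Proof. by move=> i j /(congr1 val) /= /val_inj. Qed.

Definition extend (x : forall i, H (@lead N i)) (y : L) : forall k, H k :=
  fun k => match lead_or_last k with
  | inleft (exist i e) => ecast j (H j) e (x i)
  | inright e => ecast j (H j) e y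
  end.

Lemma extend_lead x y i : extend x y (lead i) = x i.
Proof.
rewrite /extend; case: lead_or_last => [[j e]|e].
  by have ji := lead_inj e; subst j; rewrite eq_axiomK.
by case/eqP: (lead_neq_last i).
Qed.

Lemma extend_last x y : extend x y (last_factor hN) = y.
Proof.
rewrite /extend; case: lead_or_last => [[j e]|e]; last by rewrite eq_axiomK.
by case/eqP: (lead_neq_last j).
Qed.

Lemma extend_ext (z z' : forall k, H k) :
  (forall i : 'I_N.-1, z (lead i) = z' (lead i)) ->
  z (last_factor hN) = z' (last_factor hN) -> z = z'.
Proof.
move=> zl zn; apply: functional_extensionality_dep => k.
by case: (lead_or_last k) => [[i <-]|<-].
Qed.

Lemma dfwith_lead (z : forall k, H k) i (u : H (lead i)) j :
  dfwith z u (lead j) = dfwith (fun i => z (lead i)) u j.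
Proof.
have [ij|ij] := eqVneq i j; first by subst j; rewrite !dfwith_in.
by rewrite !dfwith_out // (inj_eq lead_inj).
Qed.

Lemma extend_dfwith_lead x y i (u : H (lead i)) :
  extend (dfwith x u) y = dfwith (extend x y) u.
Proof.
apply: extend_ext => [j|].
  rewrite extend_lead; have [ij|ij] := eqVneq i j.
    by subst j; rewrite !dfwith_in.
  by rewrite !dfwith_out ?extend_lead // (inj_eq lead_inj).
by rewrite dfwith_out ?lead_neq_last // !extend_last.
Qed.

Lemma extend_last_dfwith x y (u : L) :
  extend x u = dfwith (extend x y) u.
Proof.
apply: extend_ext => [j|]; last by rewrite extend_last dfwith_in.
by rewrite dfwith_out 1?eq_sym ?lead_neq_last // !extend_lead.
Qed.

Lemma extend_restrict (z : forall k, H k) :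
  extend (fun i => z (lead i)) (z (last_factor hN)) = z.
Proof. by apply: extend_ext => [i|]; rewrite ?extend_lead ?extend_last. Qed.

(* The canonical bilinear map (H_1 \otimes ... \otimes H_{N-1}) x H_N ->
   H_1 \otimes ... \otimes H_N; see [tjoin_pure] and [tjoin_unique]. *)
Definition tjoin : 'Hom(K, 'Hom(L, T)) :=
  xget 0 [set m : 'Hom(K, 'Hom(L, T)) | forall x : (forall k, H k),
    m (pure K (fun i => x (lead i))) (x (last_factor hN)) = pure T x].

Lemma tjoin_pure (x : forall k, H k) :
  tjoin (pure K (fun i => x (lead i))) (x (last_factor hN)) = pure T x.
Proof.
suff : exists m : 'Hom(K, 'Hom(L, T)), forall x : (forall k, H k),
    m (pure K (fun i => x (lead i))) (x (last_factor hN)) = pure T x.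
  by move=> /(xgetPex 0); apply.
pose f (x : forall i, H (@lead N i)) : 'Hom(L, T) :=
  linfun (fun y => pure T (extend x y)).
have fE x0 y : f x0 y = pure T (extend x0 y).
  have lin : linear (fun y : L => pure T (extend x0 y)).
    move=> a u v; rewrite (extend_last_dfwith x0 0 (a *: u + v)).
    by rewrite pure_multilinear -!extend_last_dfwith.
  pose l := GRing.isLinear.Build _ _ _ _ _ lin.
  pose g : {linear L -> T} := HB.pack (fun y : L => pure T (extend x0 y)) l.
  by rewrite -[RHS]/(g y) -(lfunE g y).
have [|m [mP _]] := @pure_universal _ _ _ K _ f.
  move=> i x0 a u v; apply/lfunP => y.
  by rewrite add_lfunE scale_lfunE !fE !extend_dfwith_lead pure_multilinear.
by exists m => z; rewrite mP fE extend_restrict.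
Qed.

Lemma tjoin_extend x y : tjoin (pure K x) y = pure T (extend x y).
Proof.
rewrite -tjoin_pure extend_last; congr (tjoin (pure K _) y).
by apply: functional_extensionality_dep => i; rewrite extend_lead.
Qed.

Lemma tjoin_unique (m : 'Hom(K, 'Hom(L, T))) :
  (forall x : (forall k, H k),
    m (pure K (fun i => x (lead i))) (x (last_factor hN)) = pure T x) ->
  m = tjoin.
Proof.
move=> mP; apply: (@pure_extend _ _ _ K) => x; apply/lfunP => y.
rewrite tjoin_extend -mP extend_last; congr (m (pure K _) y).
by apply: functional_extensionality_dep => i; rewrite extend_lead.
Qed.

(* A |-> A \otimes 1_{H_N}; see [ampliationE] and [ampliation_unique]. *)
Definition ampliation (A : 'End(K)) : 'End(T) :=
  xget 0 [set B : 'End(T) | forall x y, B (tjoin x y) = tjoin (A x) y].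

Lemma ampliationE (A : 'End(K)) x y : ampliation A (tjoin x y) = tjoin (A x) y.
Proof.
suff : exists B : 'End(T), forall x y, B (tjoin x y) = tjoin (A x) y.
  by move=> /(xgetPex 0); apply.
pose f (z : forall k, H k) : T :=
  tjoin (A (pure K (fun i => z (lead i)))) (z (last_factor hN)).
have [|B [BP _]] := @pure_universal _ _ _ T _ f.
  move=> k z a u v; rewrite /f; case: (lead_or_last k) => [[i ik]|ik]; subst k.
    rewrite !dfwith_out ?lead_neq_last //.
    have dE (w : H (lead i)) : pure K (fun j => dfwith z w (lead j)) =
        pure K (dfwith (fun j => z (lead j)) w).
      by congr (pure K _); apply: functional_extensionality_dep => j; rewrite dfwith_lead.
        by rewrite !dE pure_multilinear !linearP add_lfunE scale_lfunE.
  rewrite !dfwith_in linearP.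
  have dE (w : L) : pure K (fun j => dfwith z w (lead j)) =
      pure K (fun j => z (lead j)).
    congr (pure K _); apply: functional_extensionality_dep => j.
    by rewrite dfwith_out 1?eq_sym ?lead_neq_last.
  by rewrite !dE.
exists B => {}x {}y.
pose F := linfun (fun m : 'Hom(L, T) => m y).
have FE m : F m = m y.
  have lin : linear (fun m : 'Hom(L, T) => m y).
    by move=> a u v; rewrite add_lfunE scale_lfunE.
  pose l := GRing.isLinear.Build _ _ _ _ _ lin.
  pose g : {linear 'Hom(L, T) -> T} := HB.pack (fun m : 'Hom(L, T) => m y) l.
  by rewrite -[RHS]/(g m) -(lfunE g m).
have : (B \o (F \o tjoin) = (F \o tjoin) \o A)%VF.
  apply: (@pure_extend _ _ _ K) => x0; rewrite !comp_lfunE !FE tjoin_extend BP.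
  rewrite /f extend_last; congr (tjoin (A (pure K _)) y).
  by apply: functional_extensionality_dep => i; rewrite extend_lead.
by move=> /lfunP/(_ x); rewrite !comp_lfunE !FE.
Qed.

Lemma ampliation_unique (A : 'End(K)) (B : 'End(T)) :
  (forall x y, B (tjoin x y) = tjoin (A x) y) -> B = ampliation A.
Proof.
move=> BP; apply: (@pure_extend _ _ _ T) => x.
by rewrite -tjoin_pure BP ampliationE.
Qed.

End Ampliation.

Arguments tjoin {R N} hN {H} K T.
Arguments ampliation {R N} hN {H} K T A.

(* Main.v *)
Require Import Defs.
From HB Require Import structures.
From mathcomp Require Import all_boot all_order all_algebra.
From mathcomp Require Import complex.
From mathcomp Require Import boolp classical_sets reals.
From mathcomp Require Import ring lra.

Set Implicit Arguments.
Unset Strict Implicit.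
Unset Printing Implicit Defensive.

Import Order.TTheory GRing.Theory Num.Theory.

Local Open Scope ring_scope.

(* Let m = n_1 ... n_{N-1} and t = m^{-1/2}. For an orthonormal basis e_f of the
   first N-1 factors consisting of product vectors, each xi can be written
   sum_f e_f (x) xi_f, with |xi|^2 = sum_f |xi_f|^2. Hence
   sum_f |xi_f| <= m^{1/2} |xi|, and the ball of radius t lies in the convex
   hull of V.

   If m <= n_N, the maximally entangled vector t sum_f e_f (x) l_f purifies tau,
   and its inner product with any element of V has real part at most t, so no
   larger ball fits. Conversely a purification of tau makes the m vectors xi_f
   pairwise orthogonal of norm t, so m <= n_N.

   If n_N < m, the xi_f are linearly dependent, so their Gram matrix is at a
   definite distance from m^{-1} times the identity. Polarizing one tensor
   factor at a time gives a unit product vector z along which the component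
   of the unit vector xi has squared norm differing from m^{-1} by a constant
   independent of xi. In a product basis containing z, sum_f |xi_f| is then
   less than m^{1/2} by a constant factor, so a strictly larger ball fits. This
   quantitative form replaces duality and compactness. *)

(** * Inner products, norms and orthonormal bases *)

Section InnerProduct.
Variables (R : realType) (H : fdHilbert R).
Implicit Types (x y z : H) (a : R[i]).
Local Notation "'[ x , y ]" := (inner H x y).

Lemma inner0l y : '[0, y] = 0. Proof. exact: linear0l. Qed.
Lemma inner0r x : '[x, 0] = 0. Proof. exact: linear0r. Qed.
Lemma innerDl x y z : '[x + y, z] = '[x, z] + '[y, z].
Proof. exact: linearDl. Qed.
Lemma innerDr x y z : '[x, y + z] = '[x, y] + '[x, z].
Proof. exact: linearDr. Qed.
Lemma innerBl x y z : '[x - y, z] = '[x, z] - '[y, z].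
Proof. exact: linearBl. Qed.
Lemma innerBr x y z : '[x, y - z] = '[x, y] - '[x, z].
Proof. exact: linearBr. Qed.
Lemma innerZl a x y : '[a *: x, y] = a * '[x, y].
Proof. exact: linearZl_LR. Qed.
Lemma innerZr a x y : '[x, a *: y] = a^* * '[x, y].
Proof. exact: linearZr_LR. Qed.
Lemma inner_suml (F : finType) (v : F -> H) y :
  '[\sum_f v f, y] = \sum_f '[v f, y].
Proof. exact: linear_sumlz. Qed.
Lemma inner_sumr (F : finType) (v : F -> H) y :
  '[y, \sum_f v f] = \sum_f '[y, v f].
Proof. exact: linear_sumr. Qed.
Lemma innerC x y : '[x, y] = '[y, x]^*.
Proof. by rewrite hermC expr0 mul1r. Qed.
Lemma inner_ge0 x : 0 <= '[x, x]. Proof. exact: dnorm_ge0. Qed.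
Lemma inner_eq0 x : ('[x, x] == 0) = (x == 0). Proof. exact: dnorm_eq0. Qed.

Lemma hnorm_sqr x : (hnorm x ^+ 2)%:C%C = '[x, x].
Proof.
have /RRe_real xr : '[x, x] \is Num.real by rewrite ger0_real ?inner_ge0.
by rewrite -xr /hnorm sqr_sqrtr // -ler0c xr inner_ge0.
Qed.

Lemma hnorm_ge0 x : 0 <= hnorm x. Proof. exact: sqrtr_ge0. Qed.

Lemma hnorm_unit x : hnorm x = 1 <-> '[x, x] = 1.
Proof.
rewrite -hnorm_sqr; split=> [->|]; first by rewrite expr1n.
by move/complexI/eqP; rewrite sqrp_eq1 ?hnorm_ge0// => /eqP.
Qed.

Lemma hnormZ (r : R) x : 0 <= r -> hnorm (r%:C%C *: x) = r * hnorm x.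
Proof.
move=> r0; apply/eqP.
rewrite -(eqrXn2 (n := 2)) ?hnorm_ge0 ?mulr_ge0 ?hnorm_ge0 //.
rewrite -(inj_eq (@complexI _)) hnorm_sqr exprMn rmorphM /= hnorm_sqr.
rewrite innerZl innerZr mulrA rmorphXn expr2.
by rewrite geC0_conj ?ler0c.
Qed.

Lemma hnorm_eq0 x : (hnorm x == 0) = (x == 0).
Proof.
by rewrite -inner_eq0 -hnorm_sqr (inj_eq (@complexI _) _ 0) sqrf_eq0.
Qed.

Lemma unit_exists : (0 < \dim {:H})%N -> exists y, hnorm y = 1.
Proof.
move=> H0; pose x := vpick {:H}.
have x0 : hnorm x != 0 by rewrite hnorm_eq0 vpick0 -dimv_eq0 -lt0n.
exists ((hnorm x)^-1%:C%C *: x).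
by rewrite hnormZ ?invr_ge0 ?hnorm_ge0 // mulVf.
Qed.

(** For [x = 0] any unit vector serves, hence the assumption that one exists. *)
Lemma polar_decomposition x : (exists y, hnorm y = 1) ->
  exists2 y, hnorm y = 1 & x = (hnorm x)%:C%C *: y.
Proof.
case=> y y1; have [->|x0] := eqVneq x 0.
  exists y => //; have /eqP -> : hnorm (0 : H) == 0 by rewrite hnorm_eq0.
  by rewrite rmorph0 scale0r.
have nx0 : hnorm x != 0 by rewrite hnorm_eq0.
exists ((hnorm x)^-1%:C%C *: x).
  by rewrite hnormZ ?invr_ge0 ?hnorm_ge0 // mulVf.
by rewrite scalerA -rmorphM mulfV // scale1r.
Qed.

Lemma Re_inner_le x y : complex.Re '[x, y] <= hnorm x * hnorm y.
Proof.
have [y0|/negP/negP y0] := boolP (y == 0).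
  by rewrite (eqP y0) inner0r mulr_ge0 ?hnorm_ge0.
have ny : 0 < hnorm y by rewrite lt0r hnorm_eq0 y0 hnorm_ge0.
have xy0 := mulr_ge0 (hnorm_ge0 x) (hnorm_ge0 y).
apply: le_trans (ler_norm _) _; rewrite -lecR.
apply: le_trans (normc_ge_Re _) _.
rewrite -(ler_pXn2r (n := 2)) ?nnegrE ?normr_ge0 ?ler0c //.
have -> : (hnorm x * hnorm y)%:C%C ^+ 2 = '[x, x] * '[y, y].
  by rewrite -!hnorm_sqr -rmorphM -exprMn -rmorphXn.
exact: CauchySchwarz.
Qed.

(** By the parallelogram law the two sides differ by ['[x - y, x - y]]. *)
Lemma inner_normD_le x y : '[x + y, x + y] <= 2 * ('[x, x] + '[y, y]).
Proof.
rewrite -subr_ge0; suff -> : 2 * ('[x, x] + '[y, y]) - '[x + y, x + y] =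
  '[x - y, x - y] by exact: inner_ge0.
rewrite innerBl !innerBr innerDl !innerDr; ring.
Qed.

Definition orthonormal_basis (F : finType) (e : F -> H) : Prop :=
  (forall f g, '[e f, e g] = (f == g)%:R) /\
  (forall x, x = \sum_f '[x, e f] *: e f).

Lemma parseval (F : finType) (e : F -> H) x y : orthonormal_basis e ->
  '[x, y] = \sum_f '[x, e f] * '[e f, y].
Proof.
case=> _ eb; rewrite {1}(eb x) inner_suml.
by apply: eq_bigr => f _; rewrite innerZl.
Qed.

(** Gram-Schmidt, one vector at a time: below full dimension some [w] lies outside the span, and its
    residual [v] can be normalized. *)
Lemma orthonormal_extend (s : seq H) (k : nat) :
  orthonormal (inner H) s -> (size s + k <= \dim {:H})%N ->
  exists2 s', orthonormal (inner H) (s ++ s') & size s' = k.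
Proof.
elim: k => [|k IHk] os sk; first by exists [::]; rewrite ?cats0.
have [|s' os' s'k] := IHk os; first by apply: leq_trans sk; rewrite leq_add2l.
set u := s ++ s' in os'.
have : (<<u>> != {:H})%VS.
  apply/eqP => /(congr1 (fun U => \dim U)) du; move: sk; rewrite -du leqNgt.
  by rewrite (leq_ltn_trans (dim_span _)) // size_cat s'k addnS.
move=> neq; have [w wu] : exists w, w \notin (<<u>>)%VS.
  apply: contrapT => /forallNP all_in; case/eqP: neq; apply/vspaceP => w.
  by rewrite memvf; apply: contrapT => /negP/all_in.
have /orthonormalP[uu ue] := os'.
pose v := w - \sum_(x <- u) '[w, x] *: x.
have v0 : v != 0.
  apply: contra wu; rewrite subr_eq0 => /eqP ->; rewrite big_seq.
  by apply: memv_suml => x xu; rewrite memvZ ?memv_span.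
have vo x : x \in u -> '[v, x] = 0.
  move=> xu; rewrite innerBl linear_sumlz (bigD1_seq x) //=.
  rewrite innerZl (ue x x) // eqxx.
  rewrite mulr1 big_seq_cond big1 ?addr0 ?subrr // => y /andP[yu yx].
  by rewrite innerZl (ue y x) // (negPf yx) mulr0.
have nv : 0 < hnorm v by rewrite lt0r hnorm_eq0 v0 hnorm_ge0.
exists (rcons s' ((hnorm v)^-1%:C%C *: v)); last by rewrite size_rcons s'k.
rewrite -rcons_cat -/u.
(* Orthonormality is invariant under permutation, so the new vector may be put first. *)
have -> : orthonormal (inner H) (rcons u ((hnorm v)^-1%:C%C *: v)) =
  orthonormal (inner H) (((hnorm v)^-1%:C%C *: v) :: u).
  by apply: eq_orthonormal; rewrite perm_rcons.
have n1 : '[(hnorm v)^-1%:C%C *: v, (hnorm v)^-1%:C%C *: v] = 1.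
  by apply/hnorm_unit; rewrite hnormZ ?invr_ge0 ?hnorm_ge0 // mulVf ?gt_eqF.
apply/orthonormalP; split=> [|x y].
  rewrite /= uu andbT; apply: contra v0 => vu.
  move: (vo _ vu); rewrite innerC innerZl => /eqP.
  rewrite fmorph_eq0 mulf_eq0 inner_eq0.
  case/orP=> [/eqP/(congr1 (@complex.Re R))/=/eqP|//].
  by rewrite invr_eq0 gt_eqF.
rewrite !inE => /predU1P[->|xu] /predU1P[->|yu].
- by rewrite eqxx n1.
- rewrite innerZl vo // mulr0; case: eqP => // vy; move: n1.
  by rewrite {2}vy innerZl vo // mulr0 => /eqP; rewrite eq_sym oner_eq0.
- rewrite innerC innerZl vo // mulr0 conjC0; case: eqP => // xv; move: n1.
  by rewrite -{2}xv innerZl vo // mulr0 => /eqP; rewrite eq_sym oner_eq0.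
- exact: ue.
Qed.

Lemma orthonormal_basis_extend x : hnorm x = 1 ->
  exists2 e : 'I_(\dim {:H}) -> H, orthonormal_basis e & exists j, e j = x.
Proof.
move=> /hnorm_unit x1.
have ox : orthonormal (inner H) [:: x].
  apply/orthonormalP; split=> // y z; rewrite !inE => /eqP -> /eqP ->.
  by rewrite eqxx.
have d1 : (1 + (\dim {:H}).-1 = \dim {:H})%N.
  rewrite add1n prednK // lt0n dimv_eq0.
  apply: contraTneq (oner_neq0 R[i]) => d0.
  have : x \in (0 : {vspace H})%VS by rewrite -d0 memvf.
  by rewrite memv0 => /eqP x0; rewrite -x1 x0 inner0l eqxx.
have [|s os ss] := orthonormal_extend ox (k := (\dim {:H}).-1).
  by rewrite [size _]/= d1.
have /orthonormalP[uu ue] := os.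
have sz : size ([:: x] ++ s) == \dim {:H} by rewrite size_cat ss d1.
pose t := Tuple sz; have tb : basis_of {:H} t.
  by rewrite basisEfree (orthonormal_free os) subvf size_tuple leqnn.
exists (tnth t); last first.
  have d0 : (0 < \dim {:H})%N by rewrite -d1.
  by exists (Ordinal d0); rewrite (tnth_nth 0).
have on f g : '[tnth t f, tnth t g] = (f == g)%:R.
  by rewrite ue ?mem_tnth // (inj_eq (tuple_uniqP t uu)).
have tE (f : 'I_(\dim {:H})) : t`_f = tnth t f by rewrite (tnth_nth 0).
split=> // y; have yt : y \in (<<t>>)%VS by rewrite (span_basis tb) memvf.
rewrite [LHS](coord_span yt); apply: eq_bigr => f _.
rewrite tE; congr (_ *: _).
rewrite {2}(coord_span yt) inner_suml (bigD1 f) //= innerZl tE on eqxx.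
rewrite mulr1 big1 ?addr0 // => g gf.
by rewrite innerZl tE on (negPf gf) mulr0.
Qed.

End InnerProduct.

(** * Traces, linear dependence and linear maps *)

Section LinearAlgebra.
Variable F : fieldType.

Lemma lfun_traceE (U : vectType F) (A : 'End(U)) :
  lfun_trace A = \sum_i coord (vbasis {:U}) i (A (vbasis {:U})`_i).
Proof.
rewrite /lfun_trace /mxtrace; apply: eq_bigr => i _.
rewrite passmx.coord_rVof -(passmx.vecof_delta (vbasis {:U})).
by rewrite -passmx.mul_mxof -rowE [RHS]mxE.
Qed.

Lemma linear_dependence (U : vectType F) (I : finType) (v : I -> U) :
  (\dim {:U} < #|I|)%N ->
  exists2 c : I -> F, \sum_i c i *: v i = 0 & exists i, c i != 0.
Proof.
move=> dI; pose X := [tuple v (enum_val j) | j < #|I|].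
have XE (j : 'I_#|I|) : X`_j = v (enum_val j).
  by rewrite -(tnth_mktuple (fun j => v (enum_val j)) j) (tnth_nth 0).
have nf : ~~ free X.
  apply/negP => /eqP fX; move: dI; rewrite ltnNge -(size_tuple X) -fX.
  by rewrite dimvS ?subvf.
have /existsNP[k /not_implyP[k0 /existsNP[j kj]]] :
    ~ forall k : 'I_#|I| -> F, \sum_j k j *: X`_j = 0 -> forall j, k j = 0.
  by move=> /freeP fX; rewrite fX in nf.
exists (k \o enum_rank).
  rewrite -[RHS]k0 (reindex (@enum_val I I)) /=; last first.
    exact/onW_bij/enum_val_bij.
  by apply: eq_bigr => i _; rewrite enum_valK XE.
by exists (enum_val j); rewrite /= enum_valK; apply/eqP.
Qed.

Lemma linear_linfunE (U V : vectType F) (f : U -> V) :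
  linear f -> forall x, linfun f x = f x.
Proof.
move=> lin x; pose l := GRing.isLinear.Build _ _ _ _ _ lin.
by pose g : {linear U -> V} := HB.pack f l; rewrite -[RHS]/(g x) -(lfunE g x).
Qed.

End LinearAlgebra.

(** * Distributivity over dependent index families *)

Section FprodSum.
Variables (C : comNzRingType) (I : finType) (J : I -> finType).

Lemma prod_sum_fprod (F : forall i, J i -> C) :
  \prod_i \sum_j F i j = \sum_(f : fprod J) \prod_i F i (f i).
Proof.
pose P i := [ffun j => F i j].
transitivity (\sum_(f : fprod J) \prod_(i in I) P i (f i)); last first.
  by apply: eq_bigr => f _; apply: eq_bigr => i _; rewrite ffunE.
rewrite (big_fprod 1 +%R P) -[RHS](bigA_distr_big_dep (tagged_with J)
  (fun i => untag 0 (P i))).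
apply: eq_bigr => i _; rewrite -[RHS](big_tag (fun i => P i)).
by apply: eq_bigr => j _; rewrite ffunE.
Qed.

End FprodSum.

(** * The trace in an orthonormal basis *)

Section InnerBasis.
Variables (R : realType) (H : fdHilbert R).
Local Notation "'[ x , y ]" := (inner H x y).

Lemma inner_inj (x y : H) : (forall z, '[x, z] = '[y, z]) -> x = y.
Proof.
by move=> xy; apply/eqP; rewrite -subr_eq0 -inner_eq0 innerBl xy subrr.
Qed.

Lemma lfun_trace_basis (F : finType) (e : F -> H) (A : 'End(H)) :
  orthonormal_basis e -> lfun_trace A = \sum_f '[A (e f), e f].
Proof.
move=> [_ eb]; rewrite lfun_traceE; set b := vbasis _.
under eq_bigr => i _ do rewrite (eb b`_i) !linear_sum.
rewrite exchange_big; apply: eq_bigr => f _.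
rewrite [in RHS](coord_vbasis (memvf (A (e f)))) inner_suml.
by apply: eq_bigr => i _; rewrite linearZ /= linearZ /= innerZl mulrC.
Qed.

End InnerBasis.

(** * Linear maps and orthonormal bases on tensor products *)

Section TensorProduct.
Variables (R : realType) (I : finType) (H : I -> fdHilbert R).
Variable T : tensorProduct H.
Local Notation "'[ x , y ]" := (inner _ x y).

Lemma eq_linear_pure (Z : vectType R[i]) (f g : T -> Z) :
  linear f -> linear g ->
  (forall x, f (pure T x) = g (pure T x)) -> f =1 g.
Proof.
move=> lf lg fg x; rewrite -(linear_linfunE lf) -(linear_linfunE lg).
congr (fun_of_lfun _ x); apply: pure_extend => y.
by rewrite !linear_linfunE.
Qed.

(** By [inner_pure] the difference of the two sides has norm zero, so no induction on the factors is
    needed. *)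
Lemma pure_scale (a : I -> R[i]) (x : forall i, H i) :
  pure T (fun i => a i *: x i) = (\prod_i a i) *: pure T x.
Proof.
apply/eqP; rewrite -subr_eq0 -inner_eq0 innerBl !innerBr !(innerZl, innerZr).
rewrite !inner_pure rmorph_prod.
under [\prod_i '[a i *: x i, a i *: x i]]eq_bigr do rewrite innerZl innerZr.
under [\prod_i '[a i *: x i, x i]]eq_bigr do rewrite innerZl.
under [\prod_i '[x i, a i *: x i]]eq_bigr do rewrite innerZr.
by rewrite !big_split /=; apply/eqP; ring.
Qed.

Lemma pure_unit (x : forall i, H i) :
  (forall i, hnorm (x i) = 1) -> hnorm (pure T x) = 1.
Proof.
move=> x1; apply/hnorm_unit; rewrite inner_pure big1 // => i _.
exact/hnorm_unit.
Qed.

(** Both sides of the expansion are linear, so it suffices to treat a pure vector. Its remainder [d]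
    is orthogonal to every [E f], and ['[d, d]] vanishes because the product of the Parseval sums of
    the factors distributes into the sum over [fprod J]. *)
Lemma pure_orthonormal_basis (J : I -> finType) (e : forall i, J i -> H i) :
  (forall i, orthonormal_basis (e i)) ->
  orthonormal_basis (fun f : fprod J => pure T (fun i => e i (f i))).
Proof.
move=> eb; set E := fun f : fprod J => _.
have Eo f g : '[E f, E g] = (f == g)%:R.
  rewrite inner_pure; case: eqP => [->|/fprodP/existsNP[i /eqP fgi]].
    by rewrite big1 // => i _; rewrite (eb i).1 eqxx.
  by rewrite (bigD1 i) //= (eb i).1 (negPf fgi) mul0r.
split=> //; apply: eq_linear_pure => [a u v|a u v|x] //.
  rewrite scaler_sumr -big_split; apply: eq_bigr => f _ /=.
  by rewrite innerDl innerZl scalerDl scalerA.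
apply/eqP; rewrite -subr_eq0 -inner_eq0; set d := _ - _.
have dE f : '[d, E f] = 0.
  rewrite innerBl inner_suml (bigD1 f) //= innerZl Eo eqxx mulr1.
  rewrite big1 ?addr0 ?subrr //.
  by move=> g gf; rewrite innerZl Eo (negPf gf) mulr0.
rewrite {2}/d innerBr inner_sumr [X in _ - X]big1 => [|f _]; last first.
  by rewrite innerZr dE mulr0.
rewrite subr0 innerBl inner_suml inner_pure.
under [\prod_i _]eq_bigr => i _ do rewrite (parseval (x i) (x i) (eb i)).
rewrite prod_sum_fprod subr_eq0; apply/eqP; apply: eq_bigr => f _.
by rewrite innerZl !inner_pure big_split.
Qed.

End TensorProduct.

(** * Splitting off the last tensor factor *)

Section Join.
Variables (R : realType) (N : nat) (hN : (1 < N)%N) (H : 'I_N -> fdHilbert R).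
Variables (K : tensorProduct (fun i => H (@lead N i))) (T : tensorProduct H).
Let L : fdHilbert R := H (last_factor hN).
Local Notation "'[ x , y ]" := (inner _ x y).
Local Notation tj := (tjoin hN K T).

Lemma prod_lead_last (C : comNzRingType) (F : 'I_N -> C) :
  \prod_i F i = (\prod_(i < N.-1) F (lead i)) * F (last_factor hN).
Proof.
clear K T L H; case: N hN F => // n hn F; rewrite big_ord_recr /=.
congr (_ * F _); last exact: val_inj.
by apply: eq_bigr => i _; congr F; apply: val_inj.
Qed.

Lemma tjoinPl (a : R[i]) (x x' : K) (y : L) :
  tj (a *: x + x') y = a *: tj x y + tj x' y.
Proof. by rewrite linearP add_lfunE scale_lfunE. Qed.

Lemma tjoinZl (a : R[i]) (x : K) (y : L) : tj (a *: x) y = a *: tj x y.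
Proof. by rewrite linearZ scale_lfunE. Qed.

Lemma tjoin_suml (F : finType) (x : F -> K) (y : L) :
  tj (\sum_f x f) y = \sum_f tj (x f) y.
Proof. by rewrite linear_sum sum_lfunE. Qed.

(** The formula holds on pure vectors and extends by linearity in one argument of [K], then in the
    other after conjugate symmetry. *)
Lemma inner_tjoin (x x' : K) (y y' : L) :
  '[tj x y, tj x' y'] = '[x, x'] * '[y, y'].
Proof.
have pp z z' w w' : '[tj (pure K z) w, tj (pure K z') w'] =
    '[pure K z, pure K z'] * '[w, w'].
  rewrite !tjoin_extend !inner_pure prod_lead_last !extend_last.
  by congr (_ * _); apply: eq_bigr => i _; rewrite !extend_lead.
have pl z u w w' : '[tj u w, tj (pure K z) w'] = '[u, pure K z] * '[w, w'].
  apply: (@eq_linear_pure _ _ _ K R[i]^o (fun u => '[tj u w, tj (pure K z) w'])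
    (fun u => '[u, pure K z] * '[w, w'])) => [a u1 u2|a u1 u2|z'].
  - by rewrite tjoinPl innerDl innerZl.
  - by rewrite innerDl innerZl mulrDl -mulrA.
  exact: pp.
rewrite innerC [in RHS]innerC [X in _ * X]innerC -rmorphM; congr (_^*).
apply: (@eq_linear_pure _ _ _ K R[i]^o (fun u => '[tj u y', tj x y])
    (fun u => '[u, x] * '[y', y])) => [a u1 u2|a u1 u2|z'].
- by rewrite tjoinPl innerDl innerZl.
- by rewrite innerDl innerZl mulrDl -mulrA.
by rewrite innerC pl rmorphM [in RHS]innerC [X in _ = _ * X]innerC.
Qed.

Section Contraction.
Variables (J : finType) (l : J -> L).
Hypothesis l_basis : orthonormal_basis l.

(** The adjoint of [tj k], a partial inner product, conjugate-linear in [k]; [contractionP] shows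
    that it does not depend on the basis [l]. *)
Definition contraction (k : K) (xi : T) : L :=
  \sum_j '[xi, tj k (l j)] *: l j.

Lemma contractionP k xi y : '[contraction k xi, y] = '[xi, tj k y].
Proof.
rewrite inner_suml [in RHS](l_basis.2 y) linear_sum inner_sumr.
by apply: eq_bigr => j _; rewrite innerZl linearZ innerZr -innerC mulrC.
Qed.

Lemma contraction_tjoin k x y : contraction k (tj x y) = '[x, k] *: y.
Proof.
by apply: inner_inj => z; rewrite contractionP inner_tjoin innerZl.
Qed.

Lemma contractionPl (a : R[i]) k k' xi :
  contraction (a *: k + k') xi = a^* *: contraction k xi + contraction k' xi.
Proof.
apply: inner_inj => z; rewrite innerDl innerZl !contractionP.
by rewrite tjoinPl innerDr innerZr.
Qed.

Lemma contractionZl (a : R[i]) k xi :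
  contraction (a *: k) xi = a^* *: contraction k xi.
Proof.
apply: inner_inj => z; rewrite innerZl !contractionP.
by rewrite tjoinZl innerZr.
Qed.

Lemma contractionZr (a : R[i]) k xi :
  contraction k (a *: xi) = a *: contraction k xi.
Proof. by apply: inner_inj => z; rewrite innerZl !contractionP innerZl. Qed.

Lemma contractionPr k : linear (contraction k).
Proof.
move=> a u v; apply: inner_inj => z.
by rewrite innerDl innerZl !contractionP innerDl innerZl.
Qed.

Variables (F : finType) (e : F -> K).
Hypothesis e_basis : orthonormal_basis e.

Lemma contraction_expand xi : xi = \sum_f tj (e f) (contraction (e f) xi).
Proof.
apply: (@eq_linear_pure _ _ _ T _ id
  (fun xi => \sum_f tj (e f) (contraction (e f) xi))) => [//|a u v|x].
  rewrite scaler_sumr -big_split; apply: eq_bigr => f _ /=.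
  by rewrite contractionPr linearP.
rewrite -(tjoin_pure hN K); set k := pure K _.
rewrite {1}(e_basis.2 k) tjoin_suml; apply: eq_bigr => f _.
by rewrite contraction_tjoin tjoinZl linearZ.
Qed.

Lemma inner_contraction xi :
  '[xi, xi] = \sum_f '[contraction (e f) xi, contraction (e f) xi].
Proof.
rewrite {2}(contraction_expand xi) inner_sumr.
by apply: eq_bigr => f _; rewrite contractionP.
Qed.

Lemma inner_ampliation (y : F -> L) (A : 'End(K)) :
  let xi := \sum_f tj (e f) (y f) in
  '[ampliation hN K T A xi, xi] = \sum_f \sum_g '[A (e f), e g] * '[y f, y g].
Proof.
move=> xi.
have -> : ampliation hN K T A xi = \sum_f ampliation hN K T A (tj (e f) (y f)).
  exact: linear_sum.
rewrite inner_suml; apply: eq_bigr => f _.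
rewrite inner_sumr; apply: eq_bigr => g _.
by rewrite ampliationE inner_tjoin.
Qed.

End Contraction.

(** Evaluating the state on matrix units shows that the [#|F|] contractions of [xi] are orthogonal
    and nonzero, hence independent in [L]. *)
Lemma purification_dim (J : finType) (l : J -> L) (F : finType)
    (e : F -> K) (xi : T) :
  orthonormal_basis l -> orthonormal_basis e -> (0 < #|F|)%N ->
  (forall A : 'End(K), lfun_trace A / #|F|%:R =
     '[ampliation hN K T A xi, xi]) -> (#|F| <= \dim {:L})%N.
Proof.
move=> lb eb F0 tauE.
have ortho f g : '[contraction l (e f) xi, contraction l (e g) xi] =
    (f == g)%:R / #|F|%:R.
  (* The matrix unit sending [e f] to [e g]: its trace is [(f == g)%:R], and its value at [xi] is
     the inner product sought. *)
  pose a z := '[z, e f] *: e g.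
  have la : linear a.
    by move=> c u v; rewrite /a innerDl innerZl scalerDl scalerA.
  have := tauE (linfun a); rewrite (lfun_trace_basis _ eb).
  rewrite {1 2}(contraction_expand lb eb xi) inner_ampliation.
  have aE h h' : '[linfun a (e h), e h'] = (h == f)%:R * (g == h')%:R.
    by rewrite linear_linfunE // innerZl !eb.1.
  rewrite (bigD1 f) //= aE eqxx mul1r big1 => [|h hf]; last first.
    by rewrite aE (negPf hf) mul0r.
  rewrite addr0 eq_sym => ->.
  rewrite (bigD1 f) //= [X in _ + X]big1 => [|h hf]; last first.
    by rewrite big1 // => h' _; rewrite aE (negPf hf) !mul0r.
  rewrite addr0 (bigD1 g) //= big1 => [|h hg]; last first.
    by rewrite aE [g == h]eq_sym (negPf hg) mulr0 mul0r.
  by rewrite addr0 aE !eqxx !mul1r.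
rewrite leqNgt; apply/negP => /linear_dependence.
move=> /(_ (fun f => contraction l (e f) xi))[c c0 [g /eqP]]; apply.
have : '[\sum_f c f *: contraction l (e f) xi, contraction l (e g) xi] = 0.
  by rewrite c0 inner0l.
rewrite inner_suml (bigD1 g) //= big1 => [|f fg]; last first.
  by rewrite innerZl ortho (negPf fg) mul0r mulr0.
rewrite innerZl ortho eqxx addr0 => /eqP; rewrite mulf_eq0 mul1r invr_eq0.
by rewrite pnatr_eq0 eqn0Ngt F0 orbF => /eqP.
Qed.

End Join.

(** * A Cauchy-Schwarz bound with a remainder *)

Section RealEstimate.
Variable R : realType.

(* [\sum_f (a f - t)^2 = 2 - 2 t \sum_f a f], so the sum of the [a f] falls
   short of its maximum [t^-1] by an amount controlled by any single
   deviation of [a j] from [t]. *)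
Lemma sum_le_of_deviation (F : finType) (a : F -> R) (t d : R) (j : F) :
  (forall f, 0 <= a f) -> \sum_f a f ^+ 2 = 1 ->
  0 <= t -> t ^+ 2 * #|F|%:R = 1 -> 0 <= d -> d <= `|a j ^+ 2 - t ^+ 2| ->
  t * \sum_f a f <= 1 - d ^+ 2 / 8.
Proof.
move=> a0 a1 t0 tF d0 dj.
have sq0 f : 0 <= (a f - t) ^+ 2 by exact: sqr_ge0.
have eS : \sum_f (a f - t) ^+ 2 = 2 - 2 * (t * \sum_f a f).
  under eq_bigr do rewrite sqrrB.
  rewrite big_split sumrB /= a1 sumr_const -[t ^+ 2 *+ _]mulr_natr tF.
  under eq_bigr do rewrite -mulr_natl mulrC -mulrA.
  by rewrite -mulr_suml; lra.
have jS : (a j - t) ^+ 2 <= \sum_f (a f - t) ^+ 2.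
  by rewrite (bigD1 j) //= lerDl sumr_ge0.
have aj1 : a j ^+ 2 <= 1.
  by rewrite -a1 (bigD1 j) //= lerDl sumr_ge0 // => f _; exact: sqr_ge0.
have t1 : t ^+ 2 <= 1.
  rewrite -tF ler_peMr ?sqr_ge0 // ler1n; apply/card_gt0P.
  by exists j.
have ajl1 : a j <= 1 by rewrite -(ler_pXn2r (n := 2)) ?nnegrE // expr1n.
have tl1 : t <= 1 by rewrite -(ler_pXn2r (n := 2)) ?nnegrE // expr1n.
(* Factor the difference of squares and use [a j + t <= 2]. This 4 and the 2 in [eS] make up the
   8. *)
have d2 : d ^+ 2 <= (a j - t) ^+ 2 * 4.
  apply: (@le_trans _ _ ((a j ^+ 2 - t ^+ 2) ^+ 2)).
    by rewrite -[leRHS]real_normK ?num_real // ler_pXn2r ?nnegrE.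
  rewrite subr_sqr exprMn ler_wpM2l // (_ : 4 = 2 ^+ 2); last by ring.
  by rewrite ler_pXn2r ?nnegrE ?addr_ge0 //; lra.
lra.
Qed.

End RealEstimate.

(** * Closed convex hulls and half-spaces *)

Section ConvexHull.
Variables (R : realType) (H : fdHilbert R).
Local Notation "'[ x , y ]" := (inner H x y).

Lemma convex_hull_sum (V : set H) (G : finType) (w : G -> R) (v : G -> H) :
  (forall g, 0 <= w g) -> \sum_g w g = 1 -> (forall g, V (v g)) ->
  convex_hull V (\sum_g (w g)%:C%C *: v g).
Proof.
move=> w0 w1 vV; have eb := @enum_val_bij G.
exists #|G|, (w \o enum_val), (v \o enum_val); split=> [i|||] /=; rewrite //.
  by rewrite -w1 [RHS](reindex (@enum_val G G)) //; exact/onW_bij.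
by rewrite [LHS](reindex (@enum_val G G)) //; exact/onW_bij.
Qed.

Lemma subset_norm_closure (V : set H) x : V x -> norm_closure V x.
Proof.
move=> Vx e e0; exists x => //; rewrite subrr.
by have /eqP -> : hnorm (0 : H) == 0 by rewrite hnorm_eq0.
Qed.

(** A closed half-space containing [V] contains its closed convex hull; approximating [x] within [e]
    costs at most [e] since [xi] is a unit vector. *)
Lemma Re_inner_hull_le (V : set H) (xi : H) (t : R) x : hnorm xi = 1 ->
  (forall v, V v -> complex.Re '[v, xi] <= t) ->
  norm_closure (convex_hull V) x -> complex.Re '[x, xi] <= t.
Proof.
have ReD (z z' : R[i]) : complex.Re (z + z') = complex.Re z + complex.Re z'.
  by case: z z' => [? ?] [? ?].
have ReZ (r : R) (z : R[i]) : complex.Re (r%:C%C * z) = r * complex.Re z.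
  by case: z => a b /=; rewrite mul0r subr0.
move=> xi1 Vt xV; apply/ler_addgt0Pr => e e0.
have [y [n [l [v [l0 l1 vV ->]]]] xye] := xV e e0; set y' := \sum_i _ in xye.
rewrite -[x](subrK y') innerDl ReD addrC; apply: lerD; last first.
  by apply: le_trans (Re_inner_le _ _) _; rewrite xi1 mulr1 ltW.
rewrite inner_suml (big_morph _ ReD (erefl : complex.Re 0 = 0)).
rewrite -[t]mul1r -l1 mulr_suml; apply: ler_sum => i _.
by rewrite innerZl ReZ ler_wpM2l ?Vt.
Qed.

End ConvexHull.

(** * Polarization of sesquilinear and multi-sesquilinear forms *)

Section Polarization.
Variable R : realType.

Lemma sesquilinear_diag_bound (U : fdHilbert R) (b : U -> U -> R[i])
    (c : R[i]) :
  (forall a u u' v, b (a *: u + u') v = a^* * b u v + b u' v) ->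
  (forall a u v v', b u (a *: v + v') = a * b u v + b u v') ->
  (forall w, inner U w w <= 1 -> `|b w w| <= c) ->
  forall u v, inner U u u <= 1 -> inner U v v <= 1 -> `|b u v| <= 4 * c.
Proof.
move=> bl br bc u v u1 v1.
have b0l w : b 0 w = 0.
  by have := bl 1 0 0 w; rewrite scaler0 addr0 conjC1 mul1r => /eqP;
    rewrite -subr_eq subrr eq_sym => /eqP.
have b0r w : b w 0 = 0.
  by have := br 1 w 0 0; rewrite scaler0 addr0 mul1r => /eqP;
    rewrite -subr_eq subrr eq_sym => /eqP.
have bZl a w z : b (a *: w) z = a^* * b w z.
  by rewrite -[_ *: _]addr0 bl b0l addr0.
have bZr a w z : b w (a *: z) = a * b w z.
  by rewrite -[_ *: _]addr0 br b0r addr0.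
pose B (e : R[i]) := b (e *: v + u) (e *: v + u).
have BE e : B e = e^* * (e * b v v + b v u) + (e * b u v + b u u).
  by rewrite /B bl !br.
have Bc e : `|e| = 1 -> `|B e| <= 4 * c.
  (* Halving brings the vector back into the unit ball, where the diagonal bound applies. *)
  move=> e1; pose w := (2^-1 : R[i]) *: (e *: v + u).
  have h2 : (2^-1 : R[i])^* = 2^-1 by rewrite conj_Creal // rpredV realn.
  have -> : B e = 4 * b w w.
    rewrite /w bZl bZr h2 -/(B e).
    by field.
  rewrite normrM normr_nat ler_wpM2l //; apply: bc.
  rewrite innerZl innerZr h2 mulrA.
  apply: (@le_trans _ _ (2^-1 * 2^-1 * (2 * (1 + 1)))); last first.
    by rewrite le_eqVlt; apply/orP; left; apply/eqP; field.
  rewrite ler_wpM2l ?mulr_ge0 ?invr_ge0 //.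
  apply: le_trans (inner_normD_le _ _) _.
  rewrite ler_wpM2l // lerD // innerZl innerZr mulrA -normCK e1.
  by rewrite expr1n mul1r.
have I2 : 'i * 'i = -1 :> R[i] by rewrite -expr2 sqrCi.
(* Four terms of size at most [4 * c] bound [4 * b u v], whence the constant 4. *)
have pol : 4 * b u v = B 1 - B (-1) - 'i * B 'i + 'i * B (- 'i).
  have cN z : (- z)^* = - z^* :> R[i] by rewrite rmorphN.
  by rewrite !BE !cN conjC1 conjCi; ring: I2.
have n4 : 0 < 4 :> R[i] by [].
rewrite -(ler_pM2l n4) -{1}(normr_nat _ 4) -normrM pol.
have -> : 4 * (4 * c) = 4 * c + 4 * c + 4 * c + 4 * c by ring.
have i1 : `|'i : R[i]| = 1 by rewrite normCi.
apply: le_trans (ler_normD _ _) _; apply: lerD; last first.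
  by rewrite normrM i1 mul1r Bc // normrN.
apply: le_trans (ler_normB _ _) _; apply: lerD; last first.
  by rewrite normrM i1 mul1r Bc.
apply: le_trans (ler_normB _ _) _; apply: lerD; rewrite Bc ?normr1 //.
by rewrite normrN normr1.
Qed.

Lemma dfwith_id (I : eqType) (U : I -> Type) (x : forall i, U i) i :
  dfwith x (x i) = x.
Proof.
by apply: functional_extensionality_dep => j; case: dfwithP.
Qed.

(** Induction on a list of indices outside which [x] and [y] agree: polarizing one slot makes them
    agree there too, at the price of a factor 4. *)
Lemma multisesquilinear_diag_bound (I : finType) (H : I -> fdHilbert R)
    (G : (forall i, H i) -> (forall i, H i) -> R[i]) (c : R[i]) :
  (forall i x y a (u v : H i), G (dfwith x (a *: u + v)) y =
     a^* * G (dfwith x u) y + G (dfwith x v) y) ->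
  (forall i x y a (u v : H i), G x (dfwith y (a *: u + v)) =
     a * G x (dfwith y u) + G x (dfwith y v)) ->
  (forall x, (forall i, inner _ (x i) (x i) <= 1) -> `|G x x| <= c) ->
  forall x y, (forall i, inner _ (x i) (x i) <= 1) ->
    (forall i, inner _ (y i) (y i) <= 1) -> `|G x y| <= 4 ^+ #|I| * c.
Proof.
move=> Gl Gr Gc.
suff main (s : seq I) x y : (forall i, inner _ (x i) (x i) <= 1) ->
    (forall i, inner _ (y i) (y i) <= 1) ->
    (forall i, i \notin s -> x i = y i) -> `|G x y| <= 4 ^+ size s * c.
  by move=> x y x1 y1; rewrite cardE; apply: main => // i; rewrite mem_enum.
elim: s x y => [|i s IHs] x y x1 y1 xy.
  rewrite expr0 mul1r (_ : x = y) ?Gc //.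
  by apply: functional_extensionality_dep => i; exact: xy.
rewrite -(dfwith_id x i) -(dfwith_id y i) exprS -mulrA.
apply: (@sesquilinear_diag_bound _ (fun u v => G (dfwith x u) (dfwith y v))).
- by move=> *; rewrite Gl.
- by move=> *; rewrite Gr.
- move=> w w1; apply: IHs => j.
  + by case: dfwithP.
  + by case: dfwithP.
  have [<-|ij] := eqVneq i j; first by rewrite !dfwith_in.
  by move=> js; rewrite !dfwith_out // xy // inE negb_or eq_sym ij.
- exact: x1.
- exact: y1.
Qed.

End Polarization.

(** * Product bases through a prescribed product vector *)

Section ProductBasis.
Variables (R : realType) (I : finType) (H : I -> fdHilbert R).
Variable K : tensorProduct H.

Lemma product_basis (z : forall i, H i) : (forall i, hnorm (z i) = 1) ->
  exists (F : finType) (e : F -> forall i, H i),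
    [/\ #|F| = (\prod_i \dim {:H i})%N, forall f i, hnorm (e f i) = 1,
        orthonormal_basis (fun f => pure K (e f)) & exists j, e j = z].
Proof.
move=> z1.
pose b i := cid2 (orthonormal_basis_extend (z1 i)).
pose l i : 'I_(\dim {:H i}) -> H i := s2val (b i).
have lb i : orthonormal_basis (l i) := s2valP (b i).
have lz i : exists j, l i j = z i := s2valP' (b i).
pose j i := sval (cid (lz i)).
have jz i : l i (j i) = z i := svalP (cid (lz i)).
pose F := fprod (fun i => 'I_(\dim {:H i})).
exists F, (fun (f : F) i => l i (f i)); split.
- by rewrite card_fprod; apply: eq_bigr => i _; rewrite card_ord.
- by move=> f i; apply/hnorm_unit; rewrite (lb i).1 eqxx.
- exact: pure_orthonormal_basis.
exists [fprod i => j i]; apply: functional_extensionality_dep => i.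
by rewrite fprodE.
Qed.

End ProductBasis.

(** * Balls inside the convex hull of product vectors *)

Section InnerRadius.
Variables (R : realType) (N : nat) (hN : (1 < N)%N) (H : 'I_N -> fdHilbert R).
Hypothesis H_nonzero : forall k : 'I_N, (0 < \dim {:H k})%N.
Variables (K : tensorProduct (fun i => H (@lead N i))) (T : tensorProduct H).
Let L : fdHilbert R := H (last_factor hN).
Local Notation "'[ x , y ]" := (inner _ x y).
Local Notation tj := (tjoin hN K T).
Local Notation m := (\prod_(i < N.-1) \dim {:H (lead i)})%N.
Local Notation V := (decomposable_unit T).

Let dim_prod_gt0 : (0 < m)%N.
Proof. by apply: prodn_gt0 => i; exact: H_nonzero. Qed.

Let last_unit : exists y : L, hnorm y = 1.
Proof. exact: (unit_exists (H_nonzero (last_factor hN))). Qed.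

Let pure_units : exists z : forall k : 'I_N, H k, forall k, hnorm (z k) = 1.
Proof.
pose u k := cid (unit_exists (H_nonzero k)).
by exists (fun k => sval (u k)) => k; exact: (svalP (u k)).
Qed.

Lemma decomposable_tjoin (z : forall i, H (@lead N i)) (y : L) :
  (forall i, hnorm (z i) = 1) -> hnorm y = 1 -> V (tj (pure K z) y).
Proof.
move=> z1 y1; exists (extend z y); last by rewrite tjoin_extend.
move=> k; case: (lead_or_last hN k) => [[i <-]|<-].
  by rewrite extend_lead.
by rewrite extend_last.
Qed.

(** Writing each [y f] as its norm times a unit vector gives nonnegative weights on elements of [V]
    of total at most 1. *)
Lemma convex_hull_tjoin (F : finType) (z : F -> forall i, H (@lead N i))
    (y : F -> L) : (0 < #|F|)%N -> (forall f i, hnorm (z f i) = 1) ->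
  \sum_f hnorm (y f) <= 1 -> convex_hull V (\sum_f tj (pure K (z f)) (y f)).
Proof.
move=> F0 z1 y1.
have /choice[u uP] : forall f, exists u, hnorm u = 1 /\
    y f = (hnorm (y f))%:C%C *: u.
  by move=> f; have [u u1 yu] := polar_decomposition (y f) last_unit; exists u.
(* The weight missing from [\sum_f hnorm (y f)] is spread over pairs of
   opposite vectors of V, which cancel. *)
pose t := (1 - \sum_f hnorm (y f)) / (2 * #|F|%:R).
have Fr : #|F|%:R != 0 :> R by rewrite pnatr_eq0 -lt0n.
have t0 : 0 <= t by rewrite divr_ge0 ?subr_ge0 ?mulr_ge0.
pose w (g : F * bool) := t + (if g.2 then hnorm (y g.1) else 0).
pose v (g : F * bool) := tj (pure K (z g.1)) (if g.2 then u g.1 else - u g.1).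
have -> : \sum_f tj (pure K (z f)) (y f) = \sum_g (w g)%:C%C *: v g.
  rewrite -(pair_bigA _ (fun f b => (w (f, b))%:C%C *: v (f, b))) /=.
  apply: eq_bigr => f _; rewrite big_bool /w /v /= addr0 linearN scalerN.
  rewrite rmorphD scalerDl addrAC subrr add0r {1}(uP f).2 linearZ //.
apply: convex_hull_sum => [[f b]||[f b]].
- by rewrite /w; apply: addr_ge0 => //=; case: b => //; exact: hnorm_ge0.
- rewrite -(pair_bigA _ (fun f b => w (f, b))) /=.
  under eq_bigr do rewrite big_bool /w /= addr0 addrAC.
  rewrite big_split /= sumr_const -mulr_natr /t.
  by field.
apply: decomposable_tjoin; first exact: z1.
have [u1 _] := uP f; rewrite /=; case: b => //.
by apply/hnorm_unit; rewrite hnormN; apply/hnorm_unit.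
Qed.

Section Ball.
Variables (J : finType) (l : J -> L).
Hypothesis l_basis : orthonormal_basis l.

Lemma sum_contraction_sqr (F : finType) (e : F -> K) (xi : T) :
  orthonormal_basis e -> hnorm xi = 1 ->
  \sum_f hnorm (contraction l (e f) xi) ^+ 2 = 1.
Proof.
move=> eb /hnorm_unit xi1; apply: (@complexI R).
rewrite rmorph_sum rmorph1 -xi1 (inner_contraction l_basis eb).
by apply: eq_bigr => f _; exact: hnorm_sqr.
Qed.

(** Each [x] is expanded along a product basis. The basis may depend on the direction [xi] of [x],
    which is what allows a radius above [t]. *)
Lemma ball_sub_hull (s : R) : 0 <= s ->
  (forall xi : T, hnorm xi = 1 ->
    exists (F : finType) (z : F -> forall i, H (@lead N i)),
      [/\ (0 < #|F|)%N, forall f i, hnorm (z f i) = 1,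
          orthonormal_basis (fun f => pure K (z f))
        & s * \sum_f hnorm (contraction l (pure K (z f)) xi) <= 1]) ->
  forall x : T, hnorm x <= s -> convex_hull V x.
Proof.
move=> s0 sP x xs.
have unitT : exists x : T, hnorm x = 1.
  by have [z z1] := pure_units; exists (pure T z); exact: pure_unit.
have [xi xi1 xE] := polar_decomposition x unitT.
have [F [z [F0 z1 zb zs]]] := sP xi xi1.
rewrite (contraction_expand l_basis zb x); apply: convex_hull_tjoin => //.
apply: le_trans zs; rewrite mulr_sumr; apply: ler_sum => f _.
by rewrite xE contractionZr // hnormZ ?hnorm_ge0 // ler_wpM2r ?hnorm_ge0.
Qed.

(* The gap by which the values [|contraction l (pure K z) xi|^2], z a product
   of unit vectors, must miss [m^-1] somewhere if [\dim H_N < m]. *)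
Definition deviation_gap : R := (2 * m%:R ^+ 2 * 4 ^+ #|'I_N.-1|)^-1.

Lemma deviation_gap_gt0 : 0 < deviation_gap.
Proof. by rewrite invr_gt0 !mulr_gt0 ?exprn_gt0 ?ltr0n. Qed.

(** If every deviation were small, polarization would make the Gram matrix of the [m] contractions
    close to [m%:R^-1] times the identity, hence nonsingular, although these vectors are
    dependent. *)
Lemma exists_deviation (xi : T) : (\dim {:L} < m)%N ->
  exists2 z : forall i, H (@lead N i), forall i, hnorm (z i) = 1 &
    deviation_gap <= `|hnorm (contraction l (pure K z) xi) ^+ 2 - m%:R^-1|.
Proof.
move=> Lm; apply: contrapT => none.
pose d := deviation_gap.
have small (z : forall i, H (@lead N i)) : (forall i, hnorm (z i) = 1) ->
    `|hnorm (contraction l (pure K z) xi) ^+ 2 - m%:R^-1| <= d.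
  move=> z1; rewrite leNgt; apply/negP => dz; apply: none; exists z => //.
  exact: ltW.
pose c x := contraction l (pure K x) xi.
(* Since [c] is conjugate-linear in each factor, the second inner product has its arguments swapped,
   so that both terms are conjugate-linear in [x] and linear in [y]. *)
pose G x y := '[c x, c y] - '[pure K y, pure K x] * m%:R^-1.
have mr : m%:R != 0 :> R[i] by rewrite pnatr_eq0 -lt0n.
(* Polarization needs the bound on unit balls, not only on unit vectors; rescaling multiplies
   [G x x] by [r ^+ 2 <= 1]. *)
have Gdiag x : (forall i, '[x i, x i] <= 1) -> `|G x x| <= d%:C%C.
  move=> x1.
  have xu i : exists u : H (lead i),
      hnorm u = 1 /\ x i = (hnorm (x i))%:C%C *: u.
    have Hi := unit_exists (H_nonzero (lead i)).
    by have [u u1 xu] := polar_decomposition (x i) Hi; exists u.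
  pose u i := sval (cid (xu i)).
  have u1 i : hnorm (u i) = 1 := (svalP (cid (xu i))).1.
  have uE i : x i = (hnorm (x i))%:C%C *: u i := (svalP (cid (xu i))).2.
  pose r := \prod_i hnorm (x i).
  have r0 : 0 <= r by apply: prodr_ge0 => i _; exact: hnorm_ge0.
  have r1 : r <= 1.
    apply: prodr_ile1 => i _; rewrite hnorm_ge0 /=.
    rewrite -(ler_pXn2r (n := 2)) ?nnegrE ?hnorm_ge0 // expr1n -lecR.
    by rewrite hnorm_sqr rmorph1.
  have pE : pure K x = r%:C%C *: pure K u.
    rewrite /r rmorph_prod -pure_scale; congr (pure K _).
    by apply: functional_extensionality_dep.
  have -> : G x x = (r ^+ 2 * (hnorm (c u) ^+ 2 - m%:R^-1))%:C%C.
    rewrite /G /c pE !contractionZl //.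
    rewrite !(innerZl, innerZr) conjCK [in RHS]rmorphM rmorphB /=.
    rewrite hnorm_sqr fmorphV rmorph_nat rmorphXn /=.
    have -> : (r%:C%C)^* = r%:C%C by rewrite geC0_conj ?ler0c.
    by rewrite ((hnorm_unit _).1 (pure_unit K u1)); ring.
  rewrite -[leLHS]RRe_real ?normr_real // lecR normc_def /= expr0n addr0.
  rewrite sqrtr_sqr normrM ger0_norm ?sqr_ge0 //.
  by rewrite -[leRHS]mul1r ler_pM ?sqr_ge0 ?small // expr_le1.
have [z z1] := pure_units.
have [F [e [eF e1 eb _]]] :=
  product_basis K (z := fun i => z (lead i)) (fun i => z1 _).
have [a a0 [g ag]] : exists2 a : F -> R[i], \sum_f a f *: c (e f) = 0 &
    exists g, a g != 0.
  by apply: linear_dependence; rewrite eF.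
(* The bound on Gram entries after polarizing all [N.-1] factors; the gap is chosen to make it
   [1 / (2 * m ^ 2)]. *)
pose eta := (4 ^+ #|'I_N.-1| * d%:C%C : R[i]).
have etaE : eta * (2 * m%:R ^+ 2) = 1.
  rewrite /eta /d /deviation_gap fmorphV !rmorphM !rmorphXn !rmorph_nat /=.
  have n4 : (4 ^+ #|'I_N.-1| : R[i]) != 0 by rewrite expf_neq0 ?pnatr_eq0.
  by field; rewrite n4 mr.
have Geta f f' : `|G (e f) (e f')| <= eta.
  apply: multisesquilinear_diag_bound => //; rewrite /G /c.
  - move=> i x y b u v; rewrite !pure_multilinear !contractionPl //.
    rewrite innerDl innerZl innerDr innerZr; ring.
  - move=> i x y b u v; rewrite !pure_multilinear !contractionPl //.
    rewrite innerDr innerZr conjCK innerDl innerZl; ring.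
  - by move=> i; rewrite ((hnorm_unit _).1 (e1 f i)).
  - by move=> i; rewrite ((hnorm_unit _).1 (e1 f' i)).
pose S := \sum_f `|a f|.
have S0 : 0 < S.
  rewrite /S (bigD1 g) //=; apply: ltr_wpDr; last by rewrite normr_gt0.
  by apply: sumr_ge0.
(* Pair the linear relation with [c (e h)] and isolate the diagonal term [a h / m]. *)
have row h : `|a h| * m%:R^-1 <= eta * S.
  have : '[\sum_f a f *: c (e f), c (e h)] = 0 by rewrite a0 inner0l.
  rewrite inner_suml.
  under eq_bigr => f _.
    rewrite innerZl (_ : '[_, _] = G (e f) (e h) + (h == f)%:R * m%:R^-1).
      rewrite mulrDr; over.
    by rewrite /G eb.1 subrK.
  rewrite big_split /= [X in _ + X](bigD1 h) //= eqxx mul1r.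
  rewrite [X in _ + (_ + X)]big1 => [|f fh]; last first.
    by rewrite eq_sym (negPf fh) mul0r mulr0.
  rewrite addr0 addrC => /eqP; rewrite addr_eq0 => /eqP ah.
  have -> : `|a h| * m%:R^-1 = `|a h * m%:R^-1|.
    by rewrite normrM [`|m%:R^-1|]ger0_norm // invr_ge0.
  rewrite ah normrN mulr_sumr; apply: le_trans (ler_norm_sum _ _ _) _.
  apply: ler_sum => f _; rewrite normrM mulrC ler_wpM2r //.
(* Summing the [m] rows yields [S <= S / 2], which contradicts [0 < S]. *)
have : S * m%:R^-1 <= m%:R * (eta * S).
  rewrite /S mulr_suml; apply: le_trans (ler_sum _ (fun h _ => row h)) _.
  by rewrite sumr_const eF mulr_natl.
have m0 : 0 < m%:R :> R[i] by rewrite ltr0n.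
rewrite -(ler_pM2r m0) -mulrA mulVf // mulr1.
have -> : m%:R * (eta * S) * m%:R = eta * (2 * m%:R ^+ 2) * (S / 2) by field.
rewrite etaE mul1r ler_pdivlMr // ger_pMr // => h.
by move: h; rewrite (ler_nat _ 2 1).
Qed.

Let t : R := (Num.sqrt m%:R)^-1.

Lemma inv_sqrt_sqr : t ^+ 2 = m%:R^-1.
Proof. by rewrite exprVn sqr_sqrtr ?ler0n. Qed.

Lemma inv_sqrt_gt0 : 0 < t.
Proof. by rewrite invr_gt0 sqrtr_gt0 ltr0n. Qed.

Let inv_sqrt_sqrM : t ^+ 2 * m%:R = 1.
Proof. by rewrite inv_sqrt_sqr mulVf // pnatr_eq0 -lt0n. Qed.

Lemma inv_sqrt_ball (x : T) : hnorm x <= t -> convex_hull V x.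
Proof.
apply: ball_sub_hull => [|xi xi1]; first exact: ltW inv_sqrt_gt0.
have [z z1] := pure_units.
have [F [e [eF e1 eb [j _]]]] :=
  product_basis K (z := fun i => z (lead i)) (fun i => z1 _).
exists F, e; rewrite eF; split=> //.
(* Deviation zero turns the estimate into plain Cauchy-Schwarz. *)
have -> : 1 = 1 - 0 ^+ 2 / 8 :> R by rewrite expr0n mul0r subr0.
apply: (sum_le_of_deviation (j := j)) => //.
- by move=> f; exact: hnorm_ge0.
- exact: sum_contraction_sqr.
- exact: ltW inv_sqrt_gt0.
by rewrite eF.
Qed.

Lemma larger_ball : (\dim {:L} < m)%N ->
  exists2 s : R, t < s & forall x : T, hnorm x <= s -> convex_hull V x.
Proof.
(* A uniform bound on [t] times the sum of the contraction norms of any unit vector in a suitable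
   basis, so radius [t / k] is still admissible. *)
move=> Lm; pose k := 1 - deviation_gap ^+ 2 / 8.
have d0 := deviation_gap_gt0.
have d1 : deviation_gap <= 1.
  rewrite /deviation_gap invf_le1 ?mulr_gt0 ?exprn_gt0 ?ltr0n //.
  by rewrite -!natrX -!natrM ler1n !muln_gt0 !expn_gt0 dim_prod_gt0.
have k0 : 0 < k.
  by rewrite /k; have := exprn_ile1 2 (ltW d0) d1; lra.
have k1 : k < 1 by rewrite /k; have := exprn_gt0 2 d0; lra.
exists (t / k); first by rewrite ltr_pdivlMr // gtr_pMr // inv_sqrt_gt0.
apply: ball_sub_hull => [|xi xi1].
  exact: divr_ge0 (ltW inv_sqrt_gt0) (ltW k0).
have [z z1 zd] := exists_deviation xi Lm.
have [F [e [eF e1 eb [j ej]]]] := product_basis K z1.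
exists F, e; rewrite eF; split=> //.
rewrite mulrAC ler_pdivrMr // mul1r.
apply: (sum_le_of_deviation (j := j)) => //.
- by move=> f; exact: hnorm_ge0.
- exact: sum_contraction_sqr.
- exact: ltW inv_sqrt_gt0.
- by rewrite eF.
- exact: ltW.
by rewrite ej inv_sqrt_sqr.
Qed.

(** The vector pairs an orthonormal product basis of [K] with [m] distinct basis vectors of [L], all
    with coefficient [t]. *)
Lemma maximally_entangled : (m <= \dim {:L})%N -> #|J| = \dim {:L} ->
  exists xi : T, [/\ hnorm xi = 1,
    forall A : 'End(K), lfun_trace A / m%:R = '[ampliation hN K T A xi, xi]
    & forall v, V v -> complex.Re '[v, xi] <= t].
Proof.
move=> mL JL; have [z z1] := pure_units.
have [F [e [eF e1 eb _]]] :=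
  product_basis K (z := fun i => z (lead i)) (fun i => z1 _).
have FJ : (#|F| <= #|J|)%N by rewrite eF JL.
pose i (f : F) : J := enum_val (widen_ord FJ (enum_rank f)).
have i_inj : injective i.
  by move=> f g /enum_val_inj /(congr1 val) /= /val_inj /enum_rank_inj.
have lo f g : '[l (i f), l (i g)] = (f == g)%:R.
  by rewrite l_basis.1 (inj_eq i_inj).
have tc : (t%:C%C)^* = t%:C%C by rewrite geC0_conj // ler0c ltW // inv_sqrt_gt0.
have tt : t%:C%C * t%:C%C = m%:R^-1 :> R[i].
  by rewrite -rmorphM -expr2 inv_sqrt_sqr fmorphV rmorph_nat.
pose y f := t%:C%C *: l (i f).
have yo f g : '[y f, y g] = (f == g)%:R * m%:R^-1.
  by rewrite innerZl innerZr tc lo mulrA tt mulrC.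
pose xi := \sum_f tj (pure K (e f)) (y f).
have cE k : contraction l k xi = \sum_f '[pure K (e f), k] *: y f.
  have -> : contraction l k xi =
      \sum_f contraction l k (tj (pure K (e f)) (y f)).
    apply: inner_inj => w; rewrite contractionP // !inner_suml.
    by apply: eq_bigr => f _; rewrite contractionP.
  by apply: eq_bigr => f _; rewrite contraction_tjoin.
(* Contracting [xi] is [t] times a conjugate-linear isometry; this gives both the unit norm of [xi]
   and the bound on [V]. *)
have cn (k : K) : '[contraction l k xi, contraction l k xi] = m%:R^-1 * '[k, k].
  rewrite (parseval k k eb) mulr_sumr cE inner_suml; apply: eq_bigr => f _.
  rewrite innerZl inner_sumr (bigD1 f) //= big1 => [|g gf]; last first.
    by rewrite innerZr yo eq_sym (negPf gf) mul0r mulr0.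
  rewrite addr0 innerZr yo eqxx mul1r -innerC; ring.
have tauE A : lfun_trace A / m%:R = '[ampliation hN K T A xi, xi].
  rewrite (lfun_trace_basis A eb) inner_ampliation mulr_suml.
  apply: eq_bigr => f _.
  rewrite (bigD1 f) //= [X in _ + X]big1 => [|g gf]; last first.
    by rewrite yo eq_sym (negPf gf) mul0r mulr0.
  by rewrite addr0 yo eqxx mul1r.
exists xi; split=> //.
- apply/hnorm_unit; rewrite (inner_contraction l_basis eb).
  under eq_bigr do rewrite cn eb.1 eqxx mulr1.
  by rewrite sumr_const eF -[LHS]mulr_natr mulVf // pnatr_eq0 -lt0n.
move=> _ [x x1 <-]; rewrite -(tjoin_pure hN K); set k := pure K _.
have k1 : '[k, k] = 1 by apply/hnorm_unit; exact: pure_unit.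
have -> : complex.Re '[tj k (x (last_factor hN)), xi] =
    complex.Re '[contraction l k xi, x (last_factor hN)].
  by rewrite contractionP // [in LHS]innerC; case: ('[xi, _]).
apply: le_trans (Re_inner_le _ _) _; rewrite x1 mulr1.
rewrite -(ler_pXn2r (n := 2)) ?nnegrE ?hnorm_ge0 ?(ltW inv_sqrt_gt0) //.
rewrite inv_sqrt_sqr -lecR hnorm_sqr cn k1 mulr1.
by rewrite fmorphV rmorph_nat.
Qed.

End Ball.
End InnerRadius.

Theorem theorem11p1 (R : realType) (N : nat) (hN : (1 < N)%N)
    (H : 'I_N -> fdHilbert R)
    (H_nonzero : forall k : 'I_N, (0 < \dim {:H k})%N)
    (H_monotone : forall j k : 'I_N,
       (j <= k)%N -> (\dim {:H j} <= \dim {:H k})%N)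
    (K : tensorProduct (fun i : 'I_N.-1 => H (lead i)))
    (T : tensorProduct H) :
  let n := fun k : 'I_N => \dim {:H k} : nat in
  let m := (\prod_(i < N.-1) n (lead i))%N in
  let V := decomposable_unit T in
  let tau := fun A : 'End(K) => lfun_trace A / m%:R in
  let i_ := is_inner_radius V (Num.sqrt m%:R)^-1 in
  let ii_ := exists xi : T, hnorm xi = 1 /\
    forall A : 'End(K), tau A = inner T (ampliation hN K T A xi) xi in
  let iii_ := (m <= n (last_factor hN))%N in
  (i_ <-> ii_) /\ (ii_ <-> iii_).
Proof.
move=> n m V tau i_ ii_ iii_.
have [y y1] := unit_exists (H_nonzero (last_factor hN)).
have [l lb _] := orthonormal_basis_extend y1.
have t0 : 0 < (Num.sqrt m%:R)^-1 :> R := inv_sqrt_gt0 H_nonzero.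
have i_iii : i_ -> iii_.
  move=> [_ ub]; rewrite /iii_ leqNgt; apply/negP => Lm.
  have [s ts sV] := larger_ball H_nonzero K T lb Lm.
  suff : s <= (Num.sqrt m%:R)^-1 by rewrite leNgt ts.
  apply: ub; split; first exact: ltW (lt_trans t0 ts).
  by move=> x xs; apply: subset_norm_closure; exact: sV.
have ii_iii : ii_ -> iii_.
  have [z z1] : exists z : forall k, H k, forall k, hnorm (z k) = 1.
    pose u k := cid (unit_exists (H_nonzero k)).
    by exists (fun k => sval (u k)) => k; exact: (svalP (u k)).
  have [F [e [eF e1 eb [j _]]]] :=
    product_basis K (z := fun i => z (lead i)) (fun i => z1 _).
  move=> [xi [_ tauE]]; rewrite /iii_ -[m]eF.
  apply: (purification_dim (xi := xi) lb eb) => [|A].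
    by apply/card_gt0P; exists j.
  by rewrite eF -tauE.
have iii_i_ii : iii_ -> i_ /\ ii_.
  move=> mL.
  have [xi [xi1 tauE Vt]] :=
    maximally_entangled H_nonzero K T lb mL (card_ord _).
  split; last by exists xi.
  split.
    split; first exact: ltW.
    move=> x xt; apply: subset_norm_closure.
    exact: (inv_sqrt_ball H_nonzero K lb).
  move=> s [s0 sV].
  (* The point [s xi] of the ball of radius [s] attains the value [s], while the half-space defined
     by [xi] caps the hull at [m^{-1/2}]. *)
  have : complex.Re (inner T (s%:C%C *: xi) xi) <= (Num.sqrt m%:R)^-1.
    apply: (Re_inner_hull_le xi1 Vt).
    by apply: sV => /=; rewrite hnormZ // xi1 mulr1.
  by rewrite innerZl ((hnorm_unit _).1 xi1) mulr1.
split; split.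
- by move=> /i_iii/iii_i_ii[].
- by move=> /ii_iii/iii_i_ii[].
- exact: ii_iii.
- by move=> /iii_i_ii[].
Qed.
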